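(* For every integer $q\ge 5$, the border rank of the Kronecker cube of the little Coppersmith--Winograd tensor $T_{cw,q}$ is $$\underline{\mathbf R}\bigl(T_{cw,q}^{\boxtimes 3}\bigr)=(q+2)^3 .$$
   Context: All vector spaces are finite-dimensional over $\mathbb{C}$. For $T\in A\otimes B\otimes C$, the tensor rank $\mathrm{R}(T)$ is the least $r$ such that $T=\sum_{\ell=1}^{r}x_\ell\otimes y_\ell\otimes z_\ell$ with $x_\ell\in A$, $y_\ell\in B$, $z_\ell\in C$. The border rank $\underline{\mathbf R}(T)$ is the least $r$ such that $T$ is a limit of tensors of rank at most $r$ (limit in the Euclidean topology; equivalently, $T$ lies in the Zariski closure of the set of tensors of rank at most $r$). For $q\ge 1$ let $A,B,C$ be copies of $\mathbb{C}^{q+1}$ with bases $\{a_0,\dots,a_q\}$, $\{b_0,\dots,b_q\}$, $\{c_0,\dots,c_q\}$. The little Coppersmith--Winograd tensor is $$T_{cw,q}=\sum_{j=1}^{q}\bigl(a_0\otimes b_j\otimes c_j+a_j\otimes b_0\otimes c_j+a_j\otimes b_j\otimes c_0\bigr)\in A\otimes B\otimes C.$$ The Kronecker product of $T\in A\otimes B\otimes C$ and $S\in A_1\otimes B_1\otimes C_1$ is the tensor $T\boxtimes S\in (A\otimes A_1)\otimes(B\otimes B_1)\otimes(C\otimes C_1)$, regarded as a tensor with three factors, defined bilinearly by $(a\otimes b\otimes c)\boxtimes(a'\otimes b'\otimes c')=(a\otimes a')\otimes(b\otimes b')\otimes(c\otimes c')$. Kronecker powers are $T^{\boxtimes 1}=T$,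 $T^{\boxtimes m}=T^{\boxtimes(m-1)}\boxtimes T$, so $T^{\boxtimes m}\in A^{\otimes m}\otimes B^{\otimes m}\otimes C^{\otimes m}$, a three-factor tensor. *)

(* Defs.v *)
From HB Require Import structures.
From mathcomp Require Import all_boot all_order all_algebra.
From mathcomp Require Import complex.
From mathcomp Require Import all_classical all_reals all_analysis.

Set Implicit Arguments.
Unset Strict Implicit.
Unset Printing Implicit Defensive.

Import Order.TTheory GRing.Theory Num.Theory.
Import numFieldNormedType.Exports.

Local Open Scope classical_set_scope.
Local Open Scope ring_scope.

(* The complex numbers, typed as a numFieldType so that MathComp-Analysis
   provides the topology of the modulus. *)
Definition Cplx (R : realType) : numFieldType := R[i].

(* An element of A (x) B (x) C, given by its coordinates in fixed bases of
   A, B and C indexed by I, J and K. *)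
Definition tensor (R : realType) (I J K : finType) : Type :=
  I -> J -> K -> Cplx R.

Section Rank.
Variables (R : realType) (I J K : finType).
Implicit Types (T : tensor R I J K) (r : nat).

Definition pure_tensor (x : I -> Cplx R) (y : J -> Cplx R) (z : K -> Cplx R) :
  tensor R I J K := fun i j k => x i * y j * z k.

Definition sum_of_pure T r : Prop :=
  exists (x : 'I_r -> I -> Cplx R) (y : 'I_r -> J -> Cplx R)
         (z : 'I_r -> K -> Cplx R),
    forall i j k, T i j k = \sum_(l < r) pure_tensor (x l) (y l) (z l) i j k.

Lemma sum_of_pure_ex T : exists r, `[< sum_of_pure T r >].
Proof.
exists #|{: I * J * K}|; apply/asboolP.
exists (fun l i => ((enum_val l).1.1 == i)%:R),
       (fun l j => ((enum_val l).1.2 == j)%:R),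
       (fun l k => T (enum_val l).1.1 (enum_val l).1.2 (enum_val l).2
                   * ((enum_val l).2 == k)%:R) => i j k.
rewrite (bigD1 (enum_rank (i, j, k))) //= /pure_tensor enum_rankK /=.
rewrite !eqxx !mul1r mulr1 big1 ?addr0 // => l /eqP hl.
case: (eqVneq (enum_val l).1.1 i) => [h1|_]; last by rewrite !mul0r.
case: (eqVneq (enum_val l).1.2 j) => [h2|_]; last by rewrite mulr0 mul0r.
case: (eqVneq (enum_val l).2 k) => [h3|_]; last by rewrite !mulr0.
by case: hl; rewrite -h1 -h2 -h3 -!surjective_pairing enum_valK.
Qed.

Definition tensor_rank T : nat := ex_minn (sum_of_pure_ex T).

(* Coordinatewise convergence, which on a finite-dimensional space is
   convergence in the Euclidean topology. *)
Definition tensor_cvg (S : nat -> tensor R I J K) T : Prop :=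
  forall i j k, (fun n => S n i j k) @ \oo --> T i j k.

Definition limit_of_rank_le T r : Prop :=
  exists S : nat -> tensor R I J K,
    (forall n, (tensor_rank (S n) <= r)%N) /\ tensor_cvg S T.

Lemma limit_of_rank_le_ex T : exists r, `[< limit_of_rank_le T r >].
Proof.
exists (tensor_rank T); apply/asboolP; exists (fun=> T); split=> // i j k.
exact: cvg_cst.
Qed.

Definition border_rank T : nat := ex_minn (limit_of_rank_le_ex T).

End Rank.

(* The coordinates of a (x) a' in the product basis, indexed by I * I1, are
   the products of the coordinates of a and a'; likewise for B and C. *)
Definition kron (R : realType) (I J K I1 J1 K1 : finType)
    (T : tensor R I J K) (S : tensor R I1 J1 K1) :
  tensor R (I * I1)%type (J * J1)%type (K * K1)%type :=
  fun i j k => T i.1 j.1 k.1 * S i.2 j.2 k.2.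

(* Index set of the product basis of the m-th tensor power of a space with
   basis indexed by I: by convention a point for m = 0, and I itself (rather
   than unit * I) for m = 1. *)
Fixpoint pow_index (I : finType) (m : nat) : finType :=
  match m with
  | 0 => unit
  | m'.+1 => match m' with
             | 0 => I
             | _.+1 => (pow_index I m' * I)%type
             end
  end.

Section KronPow.
Variables (R : realType) (I J K : finType) (T : tensor R I J K).

Fixpoint kron_pow (m : nat) :
  tensor R (pow_index I m) (pow_index J m) (pow_index K m) :=
  match m with
  | 0 => fun _ _ _ => 1
  | m'.+1 =>
    match m' as n return
      tensor R (pow_index I n) (pow_index J n) (pow_index K n) ->
      tensor R (pow_index I n.+1) (pow_index J n.+1) (pow_index K n.+1)
    with
    | 0 => fun _ => T
    | _.+1 => fun P => kron P T
    end (@kron_pow m')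
  end.

End KronPow.

Arguments kron_pow {R I J K} T m _ _ _.

Definition basis_vec (R : realType) (I : finType) (s : I) : I -> Cplx R :=
  fun i => (i == s)%:R.

Definition cw_tensor (R : realType) (q : nat) :
  tensor R 'I_q.+1 'I_q.+1 'I_q.+1 :=
  let e := @basis_vec R 'I_q.+1 in
  fun i j k =>
    \sum_(l < q.+1 | l != ord0)
      (pure_tensor (e ord0) (e l) (e l) i j k
       + pure_tensor (e l) (e ord0) (e l) i j k
       + pure_tensor (e l) (e l) (e ord0) i j k).

Arguments cw_tensor R q _ _ _ : clear implicits.

(* Main.v *)
Require Import Defs.
From Stdlib Require Import ZArith FMapPositive.
From mathcomp Require Import all_boot all_order all_algebra.
From mathcomp Require Import ssrZ zify ring complex.
From mathcomp Require Import all_classical all_reals all_analysis.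

(** The upper bound is a degeneration: T_cw,q is a limit of sums of q + 2 pure
tensors ([degenerationE]), and limits of bounded rank multiply under the
Kronecker product ([limit_of_rank_kron]).

The lower bound is a Koszul flattening.  Five linear forms on the first factor
turn a tensor in A (x) B (x) C into one in C^5 (x) B (x) C; contracting with B*
and wedging with C^5 gives a map from Lambda^2 C^5 (x) B* to
Lambda^3 C^5 (x) C that is linear in the tensor.  On a pure tensor it has rank
at most 6, the rank of v /\ _ on Lambda^2 C^5 ([rank_koszul]).  Rank is lower
semicontinuous, so the rank of the flattening of T is at most 6 times the border
rank of T ([rank_flattening_border]).  For the cube it therefore suffices to
find five forms whose flattening has rank at least 6 (q + 2)^3 - 5.

The forms used here ([forms]) are sums of 31 coordinate monomials that only
involve the basis vectors a_0, ..., a_5.  This makes one finite computation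
decide all q >= 5.  A slice of T_cw,q by a_0* is the identity on the span of
b_1, ..., b_q, and a slice by a_i* with 1 <= i <= 5 vanishes on b_j for j >= 6;
so an index j >= 6 in one of the three tensor positions is only carried along.  The
kernel equations of the flattening hence fall apart into systems in which every
index is either at most 5 or a fixed spectator, and all spectators behave like
the index 6: each of these systems is a piece of the one for q = 6
([koszul_map_extend], [kernel_trivial]).  That system has 3430 unknowns and
coefficients 0, 1 and -1.  Gaussian elimination over the integers
([eliminate]), whose correctness is [eliminate_kernel], leaves 106, 198, 54 and
4 unknowns free among those with 0, 1, 2 and 3 spectators
([free_count_value]).  With t = q - 5 values for every spectator the kernel has
dimension at most 4 t^3 + 54 t^2 + 198 t + 106 ([card_free]), which is
10 (q + 1)^3 - (6 (q + 2)^3 - 4). *)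

Set Implicit Arguments.
Unset Strict Implicit.
Unset Printing Implicit Defensive.

Import Order.TTheory GRing.Theory Num.Theory.
Import numFieldNormedType.Exports.
Local Open Scope classical_set_scope.
Local Open Scope ring_scope.

(** * Sparse Gaussian elimination over the integers *)

(** A linear form: pairs of an unknown and its coefficient, by decreasing
unknown. *)
Definition sparse := seq (positive * Z).

Definition scale (a : Z) (r : sparse) : sparse :=
  [seq (t.1, Z.mul a t.2) | t <- r].

Fixpoint lincomb (a : Z) (r : sparse) (b : Z) : sparse -> sparse :=
  match r with
  | [::] => scale b
  | (c, x) :: r' =>
    fix aux s := match s with
    | [::] => scale a r
    | (d, y) :: s' =>
      match Pos.compare c d with
      | Gt => (c, Z.mul a x) :: lincomb a r' b s
      | Lt => (d, Z.mul b y) :: aux s'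
      | Eq => let z := Z.add (Z.mul a x) (Z.mul b y) in
              if Z.eqb z Z0 then lincomb a r' b s'
              else (c, z) :: lincomb a r' b s'
      end
    end
  end.

(** Reduces [r] by the rows stored in [m] until its leading unknown is new, and
stores it there.  Running out of fuel only loses an equation, so that soundness
does not depend on the bound. *)
Fixpoint insert_row (fuel : nat) (m : PositiveMap.t sparse) (r : sparse) :=
  if fuel is fuel'.+1 then
    if r is (c, x) :: _ then
      if PositiveMap.find c m is Some p then
        let y := (head (xH, Z0) p).2 in
        let g := Z.gcd x y in
        insert_row fuel' m (lincomb (Z.div y g) r (Z.opp (Z.div x g)) p)
      else PositiveMap.add c r m
    else m
  else m.

Definition eliminate (rows : seq sparse) : PositiveMap.t sparse :=
  foldl (insert_row 1000) (PositiveMap.empty sparse) rows.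

(** The unknown [c] is expressed through smaller ones by the row stored under
it.  Testing this on the result replaces a proof that [insert_row] keeps the rows
sorted. *)
Definition pivotal (m : PositiveMap.t sparse) (c : positive) : bool :=
  if PositiveMap.find c m is Some ((d, x) :: r) then
    [&& Pos.eqb d c, ~~ Z.eqb x Z0 & all (fun t => Pos.ltb t.1 c) r]
  else false.

Section Elimination.
Variable F : numDomainType.

Definition ofZ (z : Z) : F := (int_of_Z z)%:~R.

Lemma ofZ0 : ofZ Z0 = 0.
Proof. by []. Qed.

Lemma ofZ1 : ofZ (Zpos xH) = 1.
Proof. by []. Qed.

Lemma ofZN a : ofZ (Z.opp a) = - ofZ a.
Proof. by rewrite /ofZ -mulrNz; congr (_ *~ _); lia. Qed.

Lemma ofZD a b : ofZ (Z.add a b) = ofZ a + ofZ b.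
Proof. by rewrite /ofZ -intrD; congr (_%:~R); lia. Qed.

Lemma ofZM a b : ofZ (Z.mul a b) = ofZ a * ofZ b.
Proof. by rewrite /ofZ -intrM; congr (_%:~R); lia. Qed.

Lemma ofZ_eq0 a : (ofZ a == 0) = Z.eqb a Z0.
Proof. by rewrite /ofZ intr_eq0; lia. Qed.

Variable y : positive -> F.

Definition dot (r : sparse) : F := \sum_(t <- r) ofZ t.2 * y t.1.

Lemma dot_nil : dot [::] = 0.
Proof. exact: big_nil. Qed.

Lemma dot_cons c x r : dot ((c, x) :: r) = ofZ x * y c + dot r.
Proof. exact: big_cons. Qed.

Lemma dot_scale a r : dot (scale a r) = ofZ a * dot r.
Proof.
rewrite /dot big_map mulr_sumr; apply: eq_bigr => t _.
by rewrite ofZM mulrA.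
Qed.

Lemma dot_lincomb a r b s : dot (lincomb a r b s) = ofZ a * dot r + ofZ b * dot s.
Proof.
elim: r s => [|[c x] r IHr] s; first by rewrite dot_scale dot_nil mulr0 add0r.
elim: s => [|[d z] s IHs]; first by rewrite dot_scale dot_nil mulr0 addr0.
rewrite [lincomb _ _ _ _]/=; case: Pos.compare_spec => [<-{IHs}|_|_].
- case: ifP => [|_]; rewrite ?dot_cons IHr ?dot_cons.
    rewrite -ofZ_eq0 ofZD !ofZM => /eqP h.
    rewrite !mulrDr !mulrA addrACA -mulrDl h; ring.
  rewrite ofZD !ofZM; ring.
- change (dot ((d, Z.mul b z) :: lincomb a ((c, x) :: r) b s) =
    ofZ a * dot ((c, x) :: r) + ofZ b * dot ((d, z) :: s)).
  by rewrite dot_cons IHs !dot_cons ofZM; ring.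
- rewrite dot_cons IHr !dot_cons ofZM; ring.
Qed.

Definition vanishes_on (m : PositiveMap.t sparse) :=
  forall c r, PositiveMap.find c m = Some r -> dot r = 0.

Lemma insert_row_vanish fuel m r :
  vanishes_on m -> dot r = 0 -> vanishes_on (insert_row fuel m r).
Proof.
elim: fuel r => //= fuel IH [|[c x] r] // hm hr.
case hp: (PositiveMap.find c m) => [p|].
  by apply: IH => //; rewrite dot_lincomb hr (hm _ _ hp) !mulr0 addr0.
move=> d r'; case: (Pos.eq_dec d c) => [->|dc].
  by rewrite PositiveMap.gss => -[<-].
by rewrite PositiveMap.gso //; apply: hm.
Qed.

Lemma eliminate_vanish rows :
  all (fun r => dot r == 0) rows -> vanishes_on (eliminate rows).
Proof.
rewrite /eliminate; move: 1000%N => fuel.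
have: vanishes_on (PositiveMap.empty sparse).
  by move=> c r; rewrite PositiveMap.gempty.
elim: rows (PositiveMap.empty _) => //= r rows IH m hm /andP[/eqP hr hrows].
by apply: IH => //; apply: insert_row_vanish.
Qed.

(** Going up through the unknowns, each pivotal one is a combination of smaller
ones, which are already known to vanish. *)
Lemma eliminate_kernel rows :
  all (fun r => dot r == 0) rows ->
  (forall c, ~~ pivotal (eliminate rows) c -> y c = 0) ->
  forall c, y c = 0.
Proof.
move=> /eliminate_vanish; move: (eliminate rows) => m hm hfree c.
have [n] := ubnP (Pos.to_nat c); elim: n c => // n IH c hc.
have [|/hfree//] := boolP (pivotal m c); rewrite /pivotal.
case hf: (PositiveMap.find c m) => [[|[d x] r]|] //.
case/and3P=> /Pos.eqb_eq hd hx hr; move/hm: hf.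
rewrite dot_cons hd; have -> : dot r = 0.
  elim: r hr => [|[e z] r IHr] /= => [_|/andP[/Pos.ltb_lt he /IHr hr]].
    exact: dot_nil.
  by rewrite dot_cons hr IH ?mulr0 ?addr0 //; lia.
by rewrite addr0 => /eqP; rewrite mulf_eq0 ofZ_eq0 (negPf hx) => /eqP.
Qed.

End Elimination.

(** * Matrices indexed by finite types, and their limits *)

Section FinMatrix.
Variable F : fieldType.

Definition mx_of (P Q : finType) (f : P -> Q -> F) : 'M[F]_(#|P|, #|Q|) :=
  \matrix_(i, j) f (enum_val i) (enum_val j).

Lemma mx_of_mul (P Q S : finType) (f : P -> Q -> F) (g : Q -> S -> F) :
  mx_of f *m mx_of g = mx_of (fun p s => \sum_q f p q * g q s).
Proof.
apply/matrixP => i j; rewrite !mxE [RHS](reindex (@enum_val Q predT)) /=; last first.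
  by exists enum_rank => ? _; rewrite ?enum_rankK ?enum_valK.
by apply: eq_bigr => l _; rewrite !mxE.
Qed.

(** A vector of the kernel is determined by its coordinates in [free], so the
kernel has dimension at most the number of those. *)
Lemma rank_ge_of_kernel (P Q : finType) (f : P -> Q -> F) (free : pred Q) :
  (forall x : Q -> F, (forall p, \sum_q f p q * x q = 0) ->
     (forall q, free q -> x q = 0) -> forall q, x q = 0) ->
  (#|Q| <= \rank (mx_of f) + #|free|)%N.
Proof.
move=> hker; set N := kermx (mx_of f)^T.
pose D : 'M[F]_(#|Q|, #|free|) := \matrix_(q, s) (enum_val q == enum_val s)%:R.
have rN : \rank N = (#|Q| - \rank (mx_of f))%N by rewrite mxrank_ker mxrank_tr.
suff: (\rank N <= #|free|)%N by rewrite rN leq_subLR addnC.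
have := mxrank_mul_ker N D; suff -> : \rank (N :&: kermx D)%MS = 0%N.
  by rewrite addn0 => <-; exact: rank_leq_col.
apply/eqP; rewrite mxrank_eq0; apply/eqP/row_matrixP => i; rewrite row0.
set v := row i _.
have vN : (v <= N)%MS by apply: submx_trans (row_sub _ _) (capmxSl _ _).
have vD : (v <= kermx D)%MS by apply: submx_trans (row_sub _ _) (capmxSr _ _).
have {}vN : v *m (mx_of f)^T = 0 by apply/sub_kermxP.
have {}vD : v *m D = 0 by apply/sub_kermxP.
clearbody v.
apply/rowP => q; rewrite [RHS]mxE -[q]enum_valK.
apply: (hker (fun q => v 0 (enum_rank q))) => [p|{}q fq].
  have /rowP/(_ (enum_rank p)) := vN; rewrite !mxE; apply: etrans.
  rewrite [in RHS](reindex enum_rank) /=; last first.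
    by exists enum_val => ? _; rewrite ?enum_rankK ?enum_valK.
  by apply: eq_bigr => q' _; rewrite !mxE !enum_rankK mulrC.
have /rowP/(_ (enum_rank_in fq q)) := vD; rewrite !mxE; apply: etrans; apply/esym.
rewrite (bigD1 (enum_rank q)) //= [D _ _]mxE enum_rankK_in // enum_rankK eqxx mulr1.
rewrite big1 ?addr0 // => q' hq'; rewrite [D _ _]mxE enum_rankK_in //.
by rewrite -(inj_eq enum_rank_inj) enum_valK (negPf hq') mulr0.
Qed.

End FinMatrix.

Section Convergence.
Variable R : realType.
Local Notation C := (Cplx R).

Definition mx_cvg m n (M : nat -> 'M[C]_(m, n)) (L : 'M[C]_(m, n)) :=
  forall i j, (fun k => M k i j) @ \oo --> L i j.

Lemma mx_cvg_mul m n p (M : nat -> 'M[C]_(m, n)) L (N : nat -> 'M[C]_(n, p)) K :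
  mx_cvg M L -> mx_cvg N K -> mx_cvg (fun k => M k *m N k) (L *m K).
Proof.
move=> hM hN i j; rewrite mxE; under eq_fun do rewrite mxE.
apply: (cvg_big add_continuous) => l _; exact: (cvgM (hM i l) (hN l j)).
Qed.

Lemma mx_cvg_cst m n (L : 'M[C]_(m, n)) : mx_cvg (fun=> L) L.
Proof. by move=> i j; exact: cvg_cst. Qed.

Lemma mx_cvg_det n (M : nat -> 'M[C]_n) L :
  mx_cvg M L -> (fun k => \det (M k)) @ \oo --> \det L.
Proof.
move=> hM; rewrite /determinant; apply: (cvg_big add_continuous) => s _.
by apply: (cvgM (cvg_cst _)); apply: (cvg_big mul_continuous) => i _; exact: hM.
Qed.

(** Lower semicontinuity of the rank.  A matrix of rank r has the form of an
identity of size r after multiplication by suitable matrices on both sides; the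
determinants of the corresponding products for [M k] tend to 1, but they vanish
if the rank of [M k] is less than r. *)
Lemma mxrank_limit_le m n (M : nat -> 'M[C]_(m, n)) L d :
  mx_cvg M L -> (forall k, \rank (M k) <= d)%N -> (\rank L <= d)%N.
Proof.
move=> hM hd; rewrite leqNgt; apply/negP => hL.
set r := \rank L in hL.
pose A : 'M[C]_(r, m) := pid_mx r *m invmx (col_ebase L).
pose B : 'M[C]_(n, r) := invmx (row_ebase L) *m pid_mx r.
have ALB : A *m L *m B = 1%:M.
  rewrite -{1}(mulmx_ebase L) /A /B !mulmxA mulmxKV ?col_ebase_unit //.
  rewrite -!mulmxA mulKVmx ?row_ebase_unit // mulmxA -/r.
  by rewrite !pid_mx_id ?pid_mx_1 ?rank_leq_row ?rank_leq_col.
have hA := @mx_cvg_cst _ _ A; have hB := @mx_cvg_cst _ _ B.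
have := mx_cvg_det (mx_cvg_mul (mx_cvg_mul hA hM) hB).
rewrite ALB det1 (_ : (fun k => _) = cst (0 : C)) => [h|].
  have e : (1 : C) = 0 by exact: norm_cvg_unique h (cvg_cst _).
  by have := oner_neq0 C; rewrite e eqxx.
apply/funext => k; rewrite /cst; apply: contraTeq hL => hdet.
rewrite -leqNgt; apply: leq_trans (hd k).
have -> : r = \rank (A *m M k *m B).
  by apply/esym; apply: mxrank_unit; rewrite unitmxE unitfE.
exact: leq_trans (mxrankM_maxl _ _) (mxrankM_maxr _ _).
Qed.

End Convergence.

(** * Rank and border rank under sums and Kronecker products *)

Section Ranks.
Variable R : realType.
Local Notation C := (Cplx R).

Lemma tensor_rank_leP (I J K : finType) (T : tensor R I J K) r :
  sum_of_pure T r -> (tensor_rank T <= r)%N.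
Proof. by move=> h; rewrite /tensor_rank; case: ex_minnP => m _; apply; apply/asboolP. Qed.

Lemma tensor_rankP (I J K : finType) (T : tensor R I J K) :
  sum_of_pure T (tensor_rank T).
Proof. by rewrite /tensor_rank; case: ex_minnP => m /asboolP. Qed.

Lemma border_rank_leP (I J K : finType) (T : tensor R I J K) r :
  limit_of_rank_le T r -> (border_rank T <= r)%N.
Proof. by move=> h; rewrite /border_rank; case: ex_minnP => m _; apply; apply/asboolP. Qed.

Lemma border_rankP (I J K : finType) (T : tensor R I J K) :
  limit_of_rank_le T (border_rank T).
Proof. by rewrite /border_rank; case: ex_minnP => m /asboolP. Qed.

Lemma sum_of_pure_add (I J K : finType) (T S : tensor R I J K) r s :
  sum_of_pure T r -> sum_of_pure S s ->
  sum_of_pure (fun i j k => T i j k + S i j k) (r + s).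
Proof.
move=> [x [y [z hT]]] [x' [y' [z' hS]]].
pose glue (P : finType) (f : 'I_r -> P -> C) (g : 'I_s -> P -> C)
  (l : 'I_(r + s)) := match fintype.split l with inl a => f a | inr b => g b end.
exists (glue _ x x'), (glue _ y y'), (glue _ z z') => i j k.
rewrite hT hS big_split_ord; congr (_ + _); apply: eq_bigr => l _; rewrite /glue.
  by rewrite (unsplitK (inl l)).
by rewrite (unsplitK (inr l)).
Qed.

Lemma sum_of_pure1 (I J K : finType) x y z :
  sum_of_pure (@pure_tensor R I J K x y z) 1.
Proof. by exists (fun=> x), (fun=> y), (fun=> z) => i j k; rewrite big_ord1. Qed.

Lemma sum_of_pure_kron (I J K I1 J1 K1 : finType) (T : tensor R I J K)
    (S : tensor R I1 J1 K1) r s :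
  sum_of_pure T r -> sum_of_pure S s -> sum_of_pure (kron T S) (r * s).
Proof.
move=> [x [y [z hT]]] [x' [y' [z' hS]]].
have e : #|{: 'I_r * 'I_s}| = (r * s)%N by rewrite card_prod !card_ord.
pose ix (l : 'I_(r * s)) : 'I_r * 'I_s := enum_val (cast_ord (esym e) l).
exists (fun l i => x (ix l).1 i.1 * x' (ix l).2 i.2),
       (fun l j => y (ix l).1 j.1 * y' (ix l).2 j.2),
       (fun l k => z (ix l).1 k.1 * z' (ix l).2 k.2) => i j k.
rewrite /kron hT hS big_distrlr /= pair_big /=.
rewrite (reindex ix) /=; last first.
  exists (fun p => cast_ord e (enum_rank p)) => p _ /=.
    by rewrite /ix enum_valK cast_ordKV.
  by rewrite /ix cast_ordK enum_rankK.
by apply: eq_bigr => l _; rewrite /pure_tensor; ring.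
Qed.

Lemma limit_of_rank_kron (I J K I1 J1 K1 : finType) (T : tensor R I J K)
    (S : tensor R I1 J1 K1) r s :
  limit_of_rank_le T r -> limit_of_rank_le S s ->
  limit_of_rank_le (kron T S) (r * s).
Proof.
move=> [T' [hT' cT]] [S' [hS' cS]]; exists (fun n => kron (T' n) (S' n)); split.
  move=> n; have := sum_of_pure_kron (tensor_rankP (T' n)) (tensor_rankP (S' n)).
  by move/tensor_rank_leP/leq_trans; apply; rewrite leq_mul.
by move=> i j k; exact: (cvgM (cT _ _ _) (cS _ _ _)).
Qed.

End Ranks.

(** * Flattenings bound the border rank from below *)

Section Flattening.
Variables (R : realType) (I J K U W : finType).
Local Notation C := (Cplx R).
(* A linear map from A to the matrices indexed by U and W. *)
Variable L : I -> U -> W -> C.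

Definition flattening (T : tensor R I J K) : 'M[C]_(#|{: U * K}|, #|{: W * J}|) :=
  mx_of (fun a b => \sum_i L i a.1 b.1 * T i b.2 a.2).

Definition contraction_mx (x : I -> C) : 'M[C]_(#|U|, #|W|) :=
  mx_of (fun u w => \sum_i L i u w * x i).

(** The flattening of x (x) y (x) z is the tensor product of the matrix L(x) with
the matrix z y^T of rank one; a factorization of L(x) through its rank gives one
of the flattening. *)
Lemma rank_flattening_pure x y z :
  (\rank (flattening (pure_tensor x y z)) <= \rank (contraction_mx x))%N.
Proof.
set M := contraction_mx x; set r := \rank M.
pose A := \matrix_(i < #|{: U * K}|, l < r)
  (col_base M (enum_rank (enum_val i).1) l * z (enum_val i).2).
pose B := \matrix_(l < r, j < #|{: W * J}|)
  (row_base M l (enum_rank (enum_val j).1) * y (enum_val j).2).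
suff -> : flattening (pure_tensor x y z) = A *m B.
  exact: leq_trans (mxrankM_maxl _ _) (rank_leq_col _).
apply/matrixP => i j; rewrite !mxE.
transitivity (M (enum_rank (enum_val i).1) (enum_rank (enum_val j).1) *
    (y (enum_val j).2 * z (enum_val i).2)).
  rewrite mxE !enum_rankK big_distrl /=; apply: eq_bigr => l _.
  by rewrite /pure_tensor; ring.
rewrite -{1}(mulmx_base M) mxE big_distrl /=; apply: eq_bigr => l _.
by rewrite !mxE; ring.
Qed.

Lemma rank_flattening_sum T r d :
  (forall x, \rank (contraction_mx x) <= d)%N -> sum_of_pure T r ->
  (\rank (flattening T) <= d * r)%N.
Proof.
move=> hd [x [y [z hT]]].
have -> : flattening T =
    \sum_(l < r) flattening (pure_tensor (x l) (y l) (z l)).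
  apply/matrixP => i j; rewrite summxE !mxE.
  under [RHS]eq_bigr do rewrite mxE; rewrite exchange_big /=.
  by apply: eq_bigr => i' _; rewrite hT mulr_sumr.
have -> : (d * r = \sum_(l < r) d)%N by rewrite sum_nat_const card_ord mulnC.
elim/big_ind2: _ => [|A a B b hA hB|l _]; first by rewrite mxrank0.
  exact: leq_trans (mxrank_add _ _) (leq_add hA hB).
exact: leq_trans (rank_flattening_pure _ _ _) (hd _).
Qed.

Lemma rank_flattening_border T d :
  (forall x, \rank (contraction_mx x) <= d)%N ->
  (\rank (flattening T) <= d * border_rank T)%N.
Proof.
move=> hd; have [S [hS cS]] := border_rankP T.
apply: (@mxrank_limit_le _ _ _ (fun n => flattening (S n))) => [i j|n].
  rewrite mxE; under eq_fun do rewrite mxE.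
  by apply: (cvg_big add_continuous) => i' _; apply: (cvgM (cvg_cst _)); exact: cS.
apply: leq_trans (rank_flattening_sum hd (tensor_rankP (S n))) _.
by rewrite leq_mul2l hS orbT.
Qed.

End Flattening.

(** * Wedging with a vector of five-space *)

Fixpoint inversions (s : seq nat) : nat :=
  if s is a :: s' then (count (fun b => b < a)%N s' + inversions s')%N else 0%N.

Definition levi (s : seq nat) : Z :=
  if uniq s then (if odd (inversions s) then Zneg xH else Zpos xH) else Z0.

Definition pairs : seq (nat * nat) :=
  [:: (0, 1); (0, 2); (0, 3); (0, 4); (1, 2); (1, 3); (1, 4); (2, 3); (2, 4);
      (3, 4)]%N.

Definition pair_at (u : nat) : nat * nat := nth (0, 0)%N pairs u.

(** The e-th coordinate of v contributes this entry to the matrix of v /\ _.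
Lambda^3 C^5 is identified with the dual of Lambda^2 C^5, so that both rows and
columns are indexed by [pairs], and the matrix is that of the bilinear form
v /\ omega /\ omega'. *)
Definition koszul (e u w : nat) : Z :=
  let: (a, b) := pair_at u in let: (c, d) := pair_at w in
  levi [:: e; a; b; c; d].

(** The coefficient of the w-th basis bivector in e_e' /\ e_f. *)
Definition wedge (e' w f : nat) : Z :=
  let: (c, d) := pair_at w in
  Z.sub (if (e' == c) && (f == d) then Zpos xH else Z0)
        (if (e' == d) && (f == c) then Zpos xH else Z0).

(** The coefficient, at u, of e_e /\ e_e' /\ e_f. *)
Definition koszul_wedge (u f e e' : nat) : Z :=
  foldr (fun w z => Z.add (Z.mul (koszul e u w) (wedge e' w f)) z) Z0 (iota 0 10).

(** This is e_e /\ e_e' = - e_e' /\ e_e. *)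
Lemma koszul_wedge_anti (u : 'I_10) (f e e' : 'I_5) :
  koszul_wedge u f e e' = Z.opp (koszul_wedge u f e' e).
Proof.
have : all (fun u => all (fun f => all (fun e => all (fun e' =>
    Z.eqb (koszul_wedge u f e e') (Z.opp (koszul_wedge u f e' e)))
  (iota 0 5)) (iota 0 5)) (iota 0 5)) (iota 0 10) by vm_compute.
have io n (i : 'I_n) : (i : nat) \in iota 0 n by rewrite mem_iota ltn_ord.
move=> /allP/(_ _ (io _ u))/allP/(_ _ (io _ f))/allP/(_ _ (io _ e)).
by move=> /allP/(_ _ (io _ e'))/Z.eqb_eq.
Qed.

Lemma pair_at_onto (e f : 'I_5) : e != f ->
  exists w : 'I_10, pair_at w = (e : nat, f : nat) \/ pair_at w = (f : nat, e : nat).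
Proof.
have : all (fun e => all (fun f => (e == f) ||
    has (fun w => (pair_at w == (e, f)) || (pair_at w == (f, e))) (iota 0 10))
  (iota 0 5)) (iota 0 5) by vm_compute.
have io n (i : 'I_n) : (i : nat) \in iota 0 n by rewrite mem_iota ltn_ord.
move=> /allP/(_ _ (io _ e))/allP/(_ _ (io _ f)).
rewrite -val_eqE => /orP[->//|/hasP[w]]; rewrite mem_iota => /andP[_ hw] h _.
by exists (Ordinal hw); case/orP: h => /eqP ->; [left|right].
Qed.

Section KoszulRank.
Variable F : numFieldType.
Local Notation ofZ := (@ofZ F).

Lemma ofZ_foldr (T : Type) (f : T -> Z) s :
  ofZ (foldr (fun t z => Z.add (f t) z) Z0 s) = \sum_(t <- s) ofZ (f t).
Proof. by elim: s => [|t s IH]; rewrite ?big_nil // big_cons /= ofZD IH. Qed.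

Lemma sum_delta2 (x v : 'I_5 -> F) (c d : 'I_5) :
  \sum_(f < 5) \sum_(e < 5) ((e == c) && (f == d))%:R * (x f * v e) = x d * v c.
Proof.
rewrite (bigD1 d) //= (bigD1 c) //= !eqxx mul1r !big1 ?addr0 // => [f fd|e ec].
  by rewrite big1 // => e _; rewrite (negPf fd) andbF mul0r.
by rewrite (negPf ec) mul0r.
Qed.

Lemma sum_wedge (x v : 'I_5 -> F) (w : nat) (c d : 'I_5) :
  pair_at w = (c : nat, d : nat) ->
  \sum_(f < 5) \sum_(e < 5) x f * (ofZ (wedge e w f) * v e) =
  x d * v c - x c * v d.
Proof.
move=> hw; rewrite -(sum_delta2 x v c d) -(sum_delta2 x v d c) -sumrB.
apply: eq_bigr => f _; rewrite -sumrB; apply: eq_bigr => e _.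
rewrite /wedge hw -Z.add_opp_r ofZD ofZN -!val_eqE /=.
by do 4?[case: (_ == _)]; rewrite /= ?ofZ0 ?ofZ1; ring.
Qed.

(** If v is not zero, v /\ C^5 is a subspace of dimension 4 of the kernel of
v /\ _ on the 10-dimensional Lambda^2 C^5: the matrix [P] of the map
f |-> v /\ f has only the multiples of v in its kernel. *)
Lemma rank_koszul (v : 'I_5 -> F) :
  (\rank (mx_of (fun u w : 'I_10 => \sum_(e < 5) ofZ (koszul e u w) * v e)%R) <= 6)%N.
Proof.
set M := mx_of _.
have [/forallP v0|] := boolP [forall e, v e == 0].
  suff -> : M = 0 by rewrite mxrank0.
  apply/matrixP => i j; rewrite !mxE big1 // => e _.
  by rewrite (eqP (v0 e)) mulr0.
rewrite negb_forall => /existsP[e0 ve0].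
pose P := mx_of (fun (w : 'I_10) (f : 'I_5) => \sum_(e' < 5) ofZ (wedge e' w f) * v e').
have MP : M *m P = 0.
  rewrite /M /P mx_of_mul; apply/matrixP => i j; rewrite !mxE.
  set u := enum_val i; set f := enum_val j.
  pose S := \sum_(e < 5) \sum_(e' < 5) ofZ (koszul_wedge u f e e') * (v e * v e').
  transitivity S.
    rewrite /S; under [RHS]eq_bigr do under eq_bigr do
      rewrite ofZ_foldr -[iota 0 10]/(index_iota 0 10) big_mkord mulr_suml.
    under [RHS]eq_bigr do rewrite exchange_big; rewrite [RHS]exchange_big /=.
    apply: eq_bigr => w _; rewrite mulr_suml; apply: eq_bigr => e _.
    by rewrite mulr_sumr; apply: eq_bigr => e' _; rewrite ofZM; ring.
  (* S pairs a symmetric matrix with an antisymmetric one. *)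
  have SN : S = - S.
    rewrite {1}/S exchange_big /= -sumrN; apply: eq_bigr => e _.
    rewrite -sumrN; apply: eq_bigr => e' _.
    by rewrite koszul_wedge_anti ofZN; ring.
  have : S *+ 2 == 0 by rewrite mulr2n {1}SN addNr.
  by rewrite mulrn_eq0 /= => /eqP.
have rP : (4 <= \rank P)%N.
  have := mxrank_ker P^T; rewrite mxrank_tr [X in (X - _)%N]card_ord => hker.
  suff: (\rank (kermx P^T) <= 1)%N by rewrite hker; lia.
  pose r : 'rV[F]_#|'I_5| := \row_i v (enum_val i).
  apply: leq_trans (rank_leq_row r); apply: mxrankS.
  apply/row_subP => i.
  have /sub_kermxP := row_sub i (kermx P^T); move: (row i _) => c hc.
  suff -> : c = (c 0 (enum_rank e0) / v e0) *: r by exact: scalemx_sub.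
  apply/rowP => j; rewrite !mxE -[j in LHS]enum_valK; set f := enum_val j.
  apply: (mulIf ve0); rewrite mulrAC divfK //.
  have [->|ne] := eqVneq f e0; first by rewrite mulrC.
  have [w hw] := pair_at_onto ne.
  have /rowP/(_ (enum_rank w)) := hc; rewrite !mxE.
  rewrite (reindex (@enum_rank 'I_5)) /=; last first.
    by exists enum_val => ? _; rewrite ?enum_rankK ?enum_valK.
  under eq_bigr do rewrite !mxE !enum_rankK mulr_sumr.
  by case: hw => hw; rewrite (sum_wedge (fun f => c 0 (enum_rank f)) v hw) => /eqP;
    rewrite subr_eq0 => /eqP.
have := mulmx0_rank_max MP; rewrite [X in (_ <= X)%N]card_ord; lia.
Qed.

End KoszulRank.

(** * The five forms and the slices of the tensor *)

Definition triple : Type := (nat * nat * nat)%type.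

Definition below (b : nat) (n : triple) : bool :=
  [&& n.1.1 < b, n.1.2 < b & n.2 < b]%N.

(** The only j such that a_i (x) b_j (x) c_k occurs in T_cw,q, if any. *)
Definition partner (i k : nat) : option nat :=
  if i == 0%N then (if k == 0%N then None else Some k)
  else if k == 0%N then Some i
  else if k == i then Some 0%N else None.

Definition partner3 (i k : triple) : option triple :=
  obind (fun a => obind (fun b => omap (fun c => (a, b, c)) (partner i.2 k.2))
    (partner i.1.2 k.1.2)) (partner i.1.1 k.1.1).

(** Five sums of dual monomials on A (x) A (x) A, each with coefficients 1.  The
rank of the flattening can only grow for a general choice of forms; these ones
keep the equations short. *)
Definition forms : seq (seq triple) :=
 [:: [:: (0, 0, 0); (0, 0, 3)];
     [:: (0, 0, 5); (0, 3, 5); (0, 5, 0); (1, 0, 4); (1, 3, 4); (3, 2, 4); (5, 0, 0)];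
     [:: (0, 2, 0); (0, 3, 2); (0, 5, 4); (1, 0, 0); (3, 0, 1); (4, 5, 0); (5, 4, 0)];
     [:: (0, 0, 2); (0, 1, 0); (0, 4, 5); (2, 0, 0); (2, 2, 2); (3, 2, 0)];
     [:: (0, 0, 1); (0, 0, 2); (1, 0, 0); (1, 2, 2); (2, 0, 3); (2, 4, 4); (4, 0, 5);
         (4, 5, 0); (5, 5, 2)]]%N.

Definition form_at (e : nat) : seq triple := nth [::] forms e.

Lemma form_bound e m : m \in form_at e -> below 6 m.
Proof.
have : all (all (fun m : triple => below 6 m)) forms by [].
have [h|h] := ltnP e (size forms); last by rewrite /form_at nth_default.
by move=> /(all_nthP [::])/(_ _ h)/allP; apply.
Qed.

Lemma partner_bound b i k j :
  (i < b)%N -> (k < b)%N -> partner i k = Some j -> (j < b)%N.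
Proof. by rewrite /partner => hi hk; do ![case: ifP => _] => // -[<-]; lia. Qed.

Lemma partner_sym i k j : partner i k = Some j -> partner i j = Some k.
Proof.
rewrite /partner; case: (eqVneq i 0%N) => [_|i0].
  by case: (eqVneq k 0%N) => // k0 [<-]; rewrite (negPf k0).
case: (eqVneq k 0%N) => [->|_]; first by case=> <-; rewrite (negPf i0) eqxx.
by case: (eqVneq k i) => // -> [<-].
Qed.

Lemma partner3_bound b i k j :
  below b i -> below b k -> partner3 i k = Some j -> below b j.
Proof.
move=> /and3P[ia ib ic] /and3P[ka kb kc]; rewrite /partner3.
case ha: (partner i.1.1 _) => [a|] //=; case hb: (partner i.1.2 _) => [c|] //=.
case hc: (partner i.2 _) => [d|] //= [<-]; rewrite /below /=.
by rewrite (partner_bound ia ka ha) (partner_bound ib kb hb) (partner_bound ic kc hc).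
Qed.

Lemma partner3_sym i k j : partner3 i k = Some j -> partner3 i j = Some k.
Proof.
rewrite /partner3; case ha: (partner i.1.1 _) => [a|] //=.
case hb: (partner i.1.2 _) => [b|] //=; case hc: (partner i.2 _) => [c|] //= [<-] /=.
rewrite (partner_sym ha) (partner_sym hb) (partner_sym hc) /=.
by case: k {ha hb hc} => [[]].
Qed.

(** * The linear system for q = 6 *)

(** The number of the unknown x_(w, j).  Larger numbers are eliminated first, so
that the unknowns with many indices 0, which occur in the most equations, come
last. *)
Definition var_code (w : nat) (j : triple) : positive :=
  N.succ_pos (N.of_nat w + 10 * (N.of_nat j.2 + 7 * (N.of_nat j.1.2 + 7 * N.of_nat j.1.1)))%num.

Definition var_decode (p : positive) : nat * triple :=
  let n := (Pos.to_nat p).-1 in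
  (n %% 10, (n %/ 490, n %/ 70 %% 7, n %/ 10 %% 7))%N.

Lemma var_code_nat w j :
  Pos.to_nat (var_code w j) = (w + 10 * (j.2 + 7 * (j.1.2 + 7 * j.1.1))).+1.
Proof.
rewrite /var_code; set n := (_ + _)%num.
have := N.succ_pos_spec n; rewrite {2}/n; move: (N.succ_pos n) => p; lia.
Qed.

Lemma var_codeK w j : (w < 10)%N -> (j.1.2 < 7)%N -> (j.2 < 7)%N ->
  var_decode (var_code w j) = (w, j).
Proof.
case: j => [[a b] c] hw hb hc; rewrite /var_decode var_code_nat.
by congr (_, (_, _, _)); move: hw hb hc => /=; lia.
Qed.

Lemma var_decodeK p : var_code (var_decode p).1 (var_decode p).2 = p.
Proof. apply: Pos2Nat.inj; rewrite var_code_nat /var_decode /=; lia. Qed.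

Definition terms (u : nat) (k : triple) : sparse :=
  flatten [seq flatten [seq
      (let z := koszul e u w in
       if Z.eqb z Z0 then [::]
       else [seq (var_code w j, z) | j <- pmap (fun m => partner3 m k) (form_at e)])
    | w <- iota 0 10] | e <- iota 0 5].

Definition add_term (t : positive * Z) (r : sparse) : sparse :=
  lincomb (Zpos xH) [:: t] (Zpos xH) r.

Definition equation (u : nat) (k : triple) : sparse :=
  foldr add_term [::] (terms u k).

Definition cells : seq triple :=
  [seq (i, j) | i <- [seq (i, j) | i <- iota 0 7, j <- iota 0 7], j <- iota 0 7].

(** Starting with the short equations keeps the rows sparse. *)
Definition equations : seq sparse :=
  sort (fun r s : sparse => (size r <= size s)%N)
    [seq equation u k | u <- iota 0 10, k <- cells].

Definition spectators (j : triple) : nat :=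
  ((j.1.1 == 6%N) + (j.1.2 == 6%N) + (j.2 == 6%N))%N.

Definition free_count (m : PositiveMap.t sparse) (s : nat) : nat :=
  count (fun c => (spectators c.2 == s) && ~~ pivotal m (var_code c.1 c.2))
    [seq (w, j) | w <- iota 0 10, j <- cells].

Lemma free_count_value :
  [seq free_count (eliminate equations) s | s <- iota 0 4] = [:: 106; 198; 54; 4]%N.
Proof. by vm_compute. Qed.

Section KoszulSystem.
Variable F : numDomainType.
Local Notation ofZ := (@ofZ F).

(** The coordinate (u, k) of the image of X under the flattening of the cube; see
[flattening_cube].  Indices are natural numbers, so that it does not depend on
q. *)
Definition koszul_map (X : nat -> triple -> F) (u : nat) (k : triple) : F :=
  \sum_(e < 5) \sum_(w < 10) ofZ (koszul e u w) *
    \sum_(m <- form_at e) oapp (X w) 0 (partner3 m k).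

Variable y : positive -> F.

Lemma dot_flatten (T : Type) (f : T -> sparse) (s : seq T) :
  dot y (flatten [seq f t | t <- s]) = \sum_(t <- s) dot y (f t).
Proof. by rewrite /dot big_flatten big_map. Qed.

Lemma sum_oapp (T S : Type) (f : T -> option S) (g : S -> F) s :
  \sum_(t <- s) oapp g 0 (f t) = \sum_(j <- pmap f s) g j.
Proof.
elim: s => [|t s IH]; first by rewrite !big_nil.
by rewrite big_cons IH /=; case: (f t) => [j|] /=; rewrite ?big_cons ?add0r.
Qed.

Lemma dot_equation u k :
  dot y (equation u k) = koszul_map (fun w j => y (var_code w j)) u k.
Proof.
transitivity (dot y (terms u k)).
  rewrite /equation; elim: (terms u k) => //= -[c z] s IH.
  by rewrite /add_term dot_lincomb IH !dot_cons dot_nil ofZ1 !mul1r addr0.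
rewrite /terms dot_flatten -[iota 0 5]/(index_iota 0 5) big_mkord.
apply: eq_bigr => e _.
rewrite dot_flatten -[iota 0 10]/(index_iota 0 10) big_mkord.
apply: eq_bigr => w _ /=; rewrite sum_oapp.
case: ifP => [|_]; last by rewrite /dot big_map mulr_sumr.
by rewrite -(@ofZ_eq0 F) => /eqP ->; rewrite mul0r dot_nil.
Qed.

End KoszulSystem.

(** * Reduction of the cube to the finite system *)

(** Reads the index 6 of the finite system as the spectator [g]. *)
Definition embed (g n : nat) : nat := if (n < 6)%N then n else g.

Definition embed3 (g n : triple) : triple :=
  (embed g.1.1 n.1.1, embed g.1.2 n.1.2, embed g.2 n.2).

Definition clamp3 (n : triple) : triple := (minn n.1.1 6, minn n.1.2 6, minn n.2 6).

(** Slices by a_m* with m at most 5 cannot tell apart the indices from 6 on. *)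
Lemma partner_embed g m k : (m < 6 <= g)%N ->
  partner m (embed g k) = omap (embed g) (partner m k).
Proof.
move=> /andP[hm hg]; rewrite /partner /embed.
case: (ltnP k 6) => hk; do ![case: eqP => /= ?] => //; try lia.
all: by rewrite ?hm ?hk ?(ltnNge k) ?hk.
Qed.

Lemma partner3_embed g m k :
  [&& 6 <= g.1.1, 6 <= g.1.2 & 6 <= g.2]%N ->
  below 6 m ->
  partner3 m (embed3 g k) = omap (embed3 g) (partner3 m k).
Proof.
move=> /and3P[ga gb gc] /and3P[ma mb mc].
rewrite /partner3 /= !partner_embed ?ma ?mb ?mc //.
by case: (partner m.1.1 _) => //= a; case: (partner m.1.2 _) => //= b;
  case: (partner m.2 _).
Qed.

Definition index3 (q : nat) : finType := ('I_q.+1 * 'I_q.+1 * 'I_q.+1)%type.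

Definition to_triple (q : nat) (j : index3 q) : triple :=
  (val j.1.1, val j.1.2, val j.2).

Lemma to_triple_inj q : injective (@to_triple q).
Proof. by move=> [[a b] c] [[a' b'] c'] [] /= /val_inj-> /val_inj-> /val_inj->. Qed.

Lemma to_triple_below q (j : index3 q) : below q.+1 (to_triple j).
Proof. by rewrite /below /= !ltn_ord. Qed.

Lemma to_triple_onto q n : below q.+1 n -> exists j : index3 q, to_triple j = n.
Proof.
case: n => [[a b] c] /and3P[/= ha hb hc].
by exists (Ordinal ha, Ordinal hb, Ordinal hc).
Qed.

Definition outer (n : triple) : triple := (maxn n.1.1 6, maxn n.1.2 6, maxn n.2 6).

Lemma embed3_clamp3 n : embed3 (outer n) (clamp3 n) = n.
Proof.
case: n => [[a b] c]; rewrite /embed3 /embed /outer /clamp3 /=.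
by congr (_, _, _); case: ifP; lia.
Qed.

Lemma clamp3_embed3 g n : [&& 6 <= g.1.1, 6 <= g.1.2 & 6 <= g.2]%N ->
  below 7 n -> clamp3 (embed3 g n) = n.
Proof.
case: n g => [[a b] c] [[a' b'] c']; rewrite /below /clamp3 /embed3 /embed /=.
by move=> hg hn; congr (_, _, _); case: ifP; lia.
Qed.

Lemma all_allpairs (S T U : Type) (f : S -> T -> U) (p : pred U) s t :
  all p [seq f a b | a <- s, b <- t] = all (fun a => all (fun b => p (f a b)) t) s.
Proof. by elim: s => //= a s IH; rewrite all_cat IH all_map. Qed.

Lemma cells_below : all (below 7) cells.
Proof. by vm_compute. Qed.

Section Kernel.
Variables (F : numDomainType) (q : nat).
Hypothesis hq : (5 <= q)%N.
Variable x : 'I_10 * index3 q -> F.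

(** Extension of x by zero to all natural indices; it lets the equations be
transported along [embed3] without regard to the bound q. *)
Definition extend (w : nat) (n : triple) : F :=
  \sum_(p : 'I_10 * index3 q) (((p.1 : nat) == w) && (to_triple p.2 == n))%:R * x p.

Lemma extendE (p : 'I_10 * index3 q) : extend p.1 (to_triple p.2) = x p.
Proof.
rewrite /extend (bigD1 p) //= !eqxx mul1r big1 ?addr0 // => p' ne.
have [e1|] := eqVneq (p'.1 : nat) p.1; last by rewrite mul0r.
have [e2|] := eqVneq (to_triple p'.2) (to_triple p.2); last by rewrite mul0r.
case/eqP: ne; case: p p' e1 e2 => [w j] [w' j'] /= /val_inj-> /to_triple_inj ->.
by [].
Qed.

Lemma extend_out w n : ~~ below q.+1 n -> extend w n = 0.
Proof.
move=> hn; rewrite /extend big1 // => p _.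
have [e|] := eqVneq (to_triple p.2) n; last by rewrite andbF mul0r.
by rewrite -e to_triple_below in hn.
Qed.

Hypothesis ker : forall (u : 'I_10) (k : index3 q),
  koszul_map extend u (to_triple k) = 0.

(** Outside the range of indices an equation only involves unknowns that are out
of range in the same position. *)
Lemma koszul_map_extend (u : 'I_10) n : koszul_map extend u n = 0.
Proof.
have [/to_triple_onto[k <-]|hn] := boolP (below q.+1 n); first exact: ker.
rewrite /koszul_map big1 // => e _; rewrite big1 // => w _.
rewrite big1_seq ?mulr0 // => m /andP[_ /form_bound hm].
case hj: (partner3 m n) => [j|] //=; apply: extend_out; apply: contra hn => hj'.
apply: partner3_bound hj' (partner3_sym hj).
by move: hm; rewrite /below; lia.
Qed.

Hypothesis free0 : forall p : 'I_10 * index3 q,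
  ~~ pivotal (eliminate equations) (var_code p.1 (clamp3 (to_triple p.2))) -> x p = 0.

(** To see that x vanishes at p, the indices of p that are at least 6 are kept as
spectators and the rest of x is read as a solution of the finite system. *)
Lemma kernel_trivial p : x p = 0.
Proof.
set j := to_triple p.2.
pose g := outer j.
have hg : [&& 6 <= g.1.1, 6 <= g.1.2 & 6 <= g.2]%N by rewrite !leq_maxr.
pose y c : F := let wi := var_decode c in
  if below 7 wi.2 then extend wi.1 (embed3 g wi.2) else 0.
have yE w i : (w < 10)%N -> below 7 i -> y (var_code w i) = extend w (embed3 g i).
  by move=> hw hi; rewrite /y var_codeK ?hi //; case/and3P: hi.
have <- : y (var_code p.1 (clamp3 j)) = x p.
  rewrite yE //; last by rewrite /below /=; lia.
  by rewrite embed3_clamp3 extendE.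
apply: (@eliminate_kernel F y equations).
  rewrite /equations all_sort all_allpairs; apply/allP => u; rewrite mem_iota => hu.
  apply/allP => k hk; apply/eqP; rewrite dot_equation.
  rewrite -[RHS](koszul_map_extend (Ordinal hu) (embed3 g k)).
  apply: eq_bigr => e _; apply: eq_bigr => w _; congr (_ * _).
  apply: eq_big_seq => m /form_bound hm; rewrite partner3_embed //.
  case hi: (partner3 m k) => [i|] //=; apply: yE => //.
  apply: partner3_bound hi; first by move: hm; rewrite /below; lia.
  by have /allP := cells_below; apply.
move=> c; rewrite -{1}(var_decodeK c) /y.
have : ((var_decode c).1 < 10)%N by rewrite /var_decode /= ltn_mod.
case: (var_decode c) => w i; rewrite [(_, _).1]/= [(_, _).2]/= => hw hc.
case: ifPn => // hi.
have [/to_triple_onto[j' hj']|/(extend_out w)//] := boolP (below q.+1 (embed3 g i)).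
rewrite -[LHS]/(extend w (embed3 g i)) -hj' (extendE (Ordinal hw, j')).
apply: free0.
by rewrite [(_, _).2]/= hj' clamp3_embed3.
Qed.

End Kernel.

Section CW.
Variables (R : realType) (q : nat).
Local Notation C := (Cplx R).
Local Notation ofZ := (@ofZ C).

Lemma sum_pair_delta (a b : 'I_q.+1) :
  \sum_(l < q.+1 | l != ord0) (a == l)%:R * (b == l)%:R =
  ((a != ord0) && (a == b))%:R :> C.
Proof.
have [->|a0] := eqVneq a ord0.
  by rewrite big1 // => l; rewrite eq_sym => /negPf ->; rewrite mul0r.
rewrite (bigD1 a) //= eqxx mul1r big1 ?addr0 1?eq_sym // => l /andP[_ la].
by rewrite eq_sym (negPf la) mul0r.
Qed.

Lemma cw_tensorE (i j k : 'I_q.+1) :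
  cw_tensor R q i j k = (partner i k == Some (j : nat))%:R.
Proof.
rewrite /cw_tensor /pure_tensor /basis_vec !big_split /=.
have -> : \sum_(l < q.+1 | l != ord0) (i == ord0)%:R * (j == l)%:R * (k == l)%:R =
    (i == ord0)%:R * ((j != ord0) && (j == k))%:R :> C.
  by rewrite -sum_pair_delta mulr_sumr; apply: eq_bigr => l _; rewrite mulrA.
have -> : \sum_(l < q.+1 | l != ord0) (i == l)%:R * (j == ord0)%:R * (k == l)%:R =
    (j == ord0)%:R * ((i != ord0) && (i == k))%:R :> C.
  by rewrite -sum_pair_delta mulr_sumr; apply: eq_bigr => l _; ring.
have -> : \sum_(l < q.+1 | l != ord0) (i == l)%:R * (j == l)%:R * (k == ord0)%:R =
    (k == ord0)%:R * ((i != ord0) && (i == j))%:R :> C.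
  by rewrite -sum_pair_delta mulr_sumr; apply: eq_bigr => l _; ring.
rewrite -!natrM -!natrD; congr (_%:R).
rewrite /partner -!val_eqE /=.
case: i j k => [i hi] [j hj] [k hk] /=.
case: (eqVneq i 0%N) => [->|i0]; case: (eqVneq k 0%N) => [->|k0] /=.
all: rewrite ?muln0 ?mul0n ?mul1n ?addn0 ?add0n ?andbF //.
- by case: (eqVneq j 0%N).
- by rewrite (inj_eq Some_inj) [k == j]eq_sym; case: (eqVneq j k) => [->|]; rewrite ?k0 ?andbF.
- by rewrite (negPf i0) muln0 add0n (inj_eq Some_inj).
- rewrite [k == i]eq_sym; case: (i == k); rewrite ?muln0 // muln1.
  by rewrite (inj_eq Some_inj) eq_sym.
Qed.

Lemma kron_cubeE (i j k : index3 q) :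
  kron_pow (cw_tensor R q) 3 i j k =
  (partner3 (to_triple i) (to_triple k) == Some (to_triple j))%:R.
Proof.
rewrite /= /kron !cw_tensorE /partner3 /=.
case: (partner i.1.1 _) => [a|]; last by rewrite !mul0r.
case: (partner i.1.2 _) => [b|] /=; last by rewrite mulr0 mul0r.
case: (partner i.2 _) => [c|] /=; last by rewrite mulr0.
by rewrite -!natrM !mulnb !(inj_eq Some_inj) !xpair_eqE.
Qed.

Definition cube_form (e : nat) (i : index3 q) : C :=
  (count_mem (to_triple i) (form_at e))%:R.

Definition cube_koszul (i : index3 q) (u w : 'I_10) : C :=
  \sum_(e < 5) ofZ (koszul e u w) * cube_form e i.

Lemma rank_contraction_koszul (x : index3 q -> C) :
  (\rank (contraction_mx cube_koszul x) <= 6)%N.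
Proof.
have -> : contraction_mx cube_koszul x = mx_of (fun u w : 'I_10 =>
    \sum_(e < 5) ofZ (koszul e u w) * (\sum_i cube_form e i * x i)).
  apply/matrixP => a b; rewrite !mxE.
  under eq_bigr do rewrite mulr_suml; rewrite exchange_big /=.
  by apply: eq_bigr => e _; rewrite mulr_sumr; apply: eq_bigr => i _; rewrite mulrA.
exact: rank_koszul.
Qed.

Hypothesis hq : (5 <= q)%N.

Lemma sum_cube_form e (g : triple -> C) :
  \sum_(i : index3 q) cube_form e i * g (to_triple i) = \sum_(m <- form_at e) g m.
Proof.
have : all (below q.+1) (form_at e).
  by apply/allP => m /form_bound; rewrite /below; lia.
rewrite /cube_form; elim: (form_at e) => [|m s IH] /=.
  by rewrite big_nil big1 // => i _; rewrite mul0r.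
move=> /andP[/to_triple_onto[i0 hi0] /IH hs]; rewrite big_cons -hs.
under eq_bigr do rewrite natrD mulrDl.
rewrite big_split /=; congr (_ + _).
rewrite (bigD1 i0) //= hi0 eqxx mul1r big1 ?addr0 // => i ne.
by rewrite -hi0 (inj_eq (@to_triple_inj q)) eq_sym (negPf ne) mul0r.
Qed.

Lemma flattening_cube (x : 'I_10 * index3 q -> C) (a : 'I_10 * index3 q) :
  \sum_(b : 'I_10 * index3 q)
    (\sum_(i : index3 q) cube_koszul i a.1 b.1 *
       kron_pow (cw_tensor R q) 3 i b.2 a.2) * x b =
  koszul_map (extend x) a.1 (to_triple a.2).
Proof.
case: a => u k; set p := fun m => partner3 m (to_triple k).
have oE w o : oapp (extend x w) 0 o = \sum_(b : 'I_10 * index3 q)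
    ((b.1 : nat) == w)%:R * ((o == Some (to_triple b.2))%:R * x b).
  case: o => [n|] /=; last by rewrite big1 // => b _; rewrite mul0r mulr0.
  by apply: eq_bigr => b _; rewrite mulrA -natrM mulnb (inj_eq Some_inj) [n == _]eq_sym.
transitivity (\sum_(b : 'I_10 * index3 q) \sum_(e < 5) \sum_(w < 10)
    ofZ (koszul e u w) * \sum_(m <- form_at e)
      ((b.1 : nat) == w)%:R * ((p m == Some (to_triple b.2))%:R * x b)); last first.
  rewrite exchange_big; apply: eq_bigr => e _; rewrite exchange_big.
  apply: eq_bigr => w _ /=; rewrite -mulr_sumr; congr (_ * _).
  by rewrite exchange_big; apply: eq_bigr => m _; rewrite oE.
apply: eq_bigr => b _; rewrite [(u, k).1]/= [(u, k).2]/=.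
under eq_bigr do rewrite kron_cubeE mulr_suml; rewrite exchange_big mulr_suml.
apply: eq_bigr => e _; rewrite (bigD1 b.1) //= [X in _ = _ + X]big1 => [|w ne]; last first.
  move: ne; rewrite eq_sym -val_eqE /= => /negPf ne.
  by rewrite big1 ?mulr0 // => m _; rewrite ne mul0r.
rewrite addr0 -(sum_cube_form e (fun m => _ * ((p m == _)%:R * x b))) mulr_suml mulr_sumr.
by apply: eq_bigr => i _; rewrite eqxx mul1r !mulrA.
Qed.

End CW.

(** * Counting the free unknowns *)

Lemma sum_clamp (G : nat -> nat) (t : nat) :
  (\sum_(j < t + 6) G (minn j 6) = \sum_(i <- iota 0 7) t ^ (i == 6) * G i)%N.
Proof.
rewrite /= !big_cons big_nil !expn0 expn1 !mul1n addn0.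
elim: t => [|t IH]; first by rewrite !big_ord_recr big_ord0 /= add0n mul0n addn0 !addnA.
rewrite big_ord_recr /= IH (minn_idPr _) ?leq_addl // mulSn; lia.
Qed.

Lemma sum_clamp3 (G : triple -> nat) (q : nat) : (5 <= q)%N ->
  (\sum_(j : index3 q) G (clamp3 (to_triple j)) =
   \sum_(i <- cells) (q - 5) ^ spectators i * G i)%N.
Proof.
move=> hq; have eq : q.+1 = (q - 5 + 6)%N by lia.
rewrite /cells !big_allpairs /=.
rewrite -(pair_big xpredT xpredT (fun ab c => G (clamp3 (to_triple (ab, c))))) /=.
rewrite -(pair_big xpredT xpredT (fun a b => \sum_(c < q.+1) G (clamp3 (to_triple ((a, b), c)))))%N /=.
pose H i j k := G (i, j, k).
transitivity (\sum_(a < q.+1) \sum_(b < q.+1) \sum_(c < q.+1)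
    H (minn a 6) (minn b 6) (minn c 6))%N; first by [].
rewrite {}eq; set t := (q - 5)%N.
transitivity (\sum_(a < t + 6) \sum_(b < t + 6)
    \sum_(k <- iota 0 7) t ^ (k == 6) * H (minn a 6) (minn b 6) k)%N.
  apply: eq_bigr => a _; apply: eq_bigr => b _.
  exact: (sum_clamp (H (minn a 6) (minn b 6)) t).
transitivity (\sum_(a < t + 6) \sum_(j <- iota 0 7) t ^ (j == 6) *
    \sum_(k <- iota 0 7) t ^ (k == 6) * H (minn a 6) j k)%N.
  apply: eq_bigr => a _.
  exact: (sum_clamp (fun j => \sum_(k <- iota 0 7) t ^ (k == 6) * H (minn a 6) j k)%N t).
rewrite (sum_clamp (fun i => \sum_(j <- iota 0 7) t ^ (j == 6) *
  \sum_(k <- iota 0 7) t ^ (k == 6) * H i j k)%N t).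
apply: eq_bigr => i _; rewrite big_distrr /=; apply: eq_bigr => j _.
rewrite !big_distrr /=; apply: eq_bigr => k _.
by rewrite /spectators !expnD !mulnA.
Qed.

Definition is_free (p : nat * triple) : bool :=
  ~~ pivotal (eliminate equations) (var_code p.1 p.2).

Lemma card_free q : (5 <= q)%N ->
  #|[pred p : 'I_10 * index3 q | is_free (p.1 : nat, clamp3 (to_triple p.2))]| =
  (4 * (q - 5) ^ 3 + 54 * (q - 5) ^ 2 + 198 * (q - 5) + 106)%N.
Proof.
move=> hq; set t := (q - 5)%N.
rewrite -sum1_card big_mkcond /=.
rewrite -(pair_big xpredT xpredT (fun (w : 'I_10) (j : index3 q) =>
  if is_free (w : nat, clamp3 (to_triple j)) then 1 else 0))%N /=.
under eq_bigr => w _ do rewrite (sum_clamp3 (fun i => if is_free (w : nat, i) then 1 else 0)%N) //.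
rewrite -(big_mkord xpredT (fun w => \sum_(i <- cells) t ^ spectators i *
  (if is_free (w, i) then 1 else 0)))%N.
rewrite /index_iota subn0.
transitivity (\sum_(p <- [seq (w, i) | w <- iota 0 10, i <- cells])
  t ^ spectators p.2 * (if is_free p then 1 else 0))%N; first by rewrite big_allpairs.
transitivity (\sum_(s <- iota 0 4) t ^ s * free_count (eliminate equations) s)%N.
  rewrite /free_count.
  under [RHS]eq_bigr do rewrite -sum1_count big_mkcond big_distrr /=.
  rewrite exchange_big /=; apply: eq_bigr => -[w i] _ /=.
  have hs : (spectators i < 4)%N by rewrite /spectators; do 3?case: eqP.
  rewrite !big_cons big_nil /=.
  move: (spectators i) hs => [|[|[|[|]]]] //= _; rewrite /is_free /=;
    case: ifP; rewrite ?muln0 ?muln1 ?addn0 //.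
have := free_count_value.
move: (eliminate equations) => m [h0 h1 h2 h3].
rewrite !big_cons big_nil h0 h1 h2 h3; lia.
Qed.

(** * A degeneration of rank q + 2 *)

Section Degeneration.
Variables (R : realType) (q : nat).
Local Notation C := (Cplx R).

Lemma cvg_invn : (fun n => n.+1%:R^-1 : C) @ \oo --> (0 : C).
Proof.
apply/cvgr0Pnorm_lt => -[e e']; rewrite ltcE /= => /andP[/eqP -> e0].
near=> n.
have : `|harmonic n : R| < e by near: n; apply: cvgr0_norm_lt => //; exact: cvg_harmonic.
rewrite /harmonic /= => h.
have -> : (n.+1%:R : C)^-1 = (n.+1%:R^-1 : R)%:C%C by rewrite fmorphV rmorph_nat.
by rewrite normc_def /= expr0n addr0 sqrtr_sqr ltcR.
Unshelve. all: by end_near. Qed.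

Let z (a : 'I_q.+1) : C := (a == ord0)%:R.
Let d (l : 'I_q) (a : 'I_q.+1) : C := (a == lift ord0 l)%:R.
Let n (a : 'I_q.+1) : C := (a != ord0)%:R.

Lemma sum_neq0 (f : 'I_q.+1 -> C) :
  \sum_(l < q.+1 | l != ord0) f l = \sum_(l < q) f (lift ord0 l).
Proof. by rewrite big_mkcond big_ord_recl /= add0r. Qed.

Lemma sum_d a : \sum_(l < q) d l a = n a.
Proof.
rewrite -(sum_neq0 (fun l => (a == l)%:R)).
have := sum_pair_delta R a a; rewrite eqxx andbT /n => <-.
by apply: eq_bigr => l _; rewrite -natrM mulnb andbb.
Qed.

Lemma cw_tensor_sum i j k : cw_tensor R q i j k =
  z i * (\sum_(l < q) d l j * d l k) + z j * (\sum_(l < q) d l i * d l k)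
  + z k * (\sum_(l < q) d l i * d l j).
Proof.
rewrite /cw_tensor sum_neq0 !mulr_sumr -!big_split /=; apply: eq_bigr => l _.
rewrite /pure_tensor /basis_vec /z /d; ring.
Qed.

(** The terms of order t^-3 and t^-2 cancel because of the last summand, those of
order t^-1 between the first two. *)
Definition degeneration (t : C) : tensor R 'I_q.+1 'I_q.+1 'I_q.+1 := fun i j k =>
  \sum_(l < q) pure_tensor (fun a => t ^- 2 * (z a + t * d l a))
    (fun a => z a + t * d l a) (fun a => z a + t * d l a) i j k
  + pure_tensor (fun a => - t ^- 3 * (z a + t ^+ 2 * n a))
      (fun a => z a + t ^+ 2 * n a) (fun a => z a + t ^+ 2 * n a) i j k
  + pure_tensor (fun a => (t ^- 3 - q%:R * t ^- 2) * z a) z z i j k.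

Lemma degeneration_rank t : (tensor_rank (degeneration t) <= q + 2)%N.
Proof.
apply: tensor_rank_leP; rewrite -[2%N]/(1 + 1)%N addnA.
apply: sum_of_pure_add (sum_of_pure1 _ _ _).
apply: sum_of_pure_add (sum_of_pure1 _ _ _).
by eexists; eexists; eexists.
Qed.

Lemma degenerationE t i j k : t != 0 ->
  degeneration t i j k = cw_tensor R q i j k + t *
   (\sum_(l < q) d l i * d l j * d l k - z i * n j * n k - n i * z j * n k
    - n i * n j * z k - t * t * (n i * n j * n k)).
Proof.
move=> t0; rewrite cw_tensor_sum /degeneration /pure_tensor.
have -> : \sum_(l < q) t ^- 2 * (z i + t * d l i) * (z j + t * d l j) * (z k + t * d l k)
   = t ^- 2 * (z i * z j * z k * q%:R)
     + t^-1 * (z i * z j * n k + z i * z k * n j + z j * z k * n i)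
     + (z i * (\sum_(l < q) d l j * d l k) + z j * (\sum_(l < q) d l i * d l k)
         + z k * (\sum_(l < q) d l i * d l j))
     + t * \sum_(l < q) d l i * d l j * d l k.
  have -> : q%:R = \sum_(l < q) 1 :> C by rewrite sumr_const card_ord.
  rewrite -!sum_d !mulr_sumr -!big_split !mulr_sumr -!big_split /=.
  by apply: eq_bigr => l _; field.
by field.
Qed.

Lemma cw_border : limit_of_rank_le (cw_tensor R q) (q + 2).
Proof.
exists (fun m => degeneration m.+1%:R^-1); split => [m|i j k].
  exact: degeneration_rank.
pose E0 := \sum_(l < q) d l i * d l j * d l k - z i * n j * n k - n i * z j * n k
    - n i * n j * z k.
rewrite (_ : (fun m => _) = fun m => cw_tensor R q i j k + (m.+1%:R^-1 : C) *
   (E0 - (m.+1%:R^-1 * m.+1%:R^-1) * (n i * n j * n k))); last first.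
  by apply/funext => m; rewrite degenerationE // invr_eq0 pnatr_eq0.
have h := cvg_invn.
rewrite -[X in _ --> X]addr0 -[X in _ --> _ + X](mul0r (E0 - (0 * 0) * (n i * n j * n k))).
apply: (cvgD (cvg_cst _)); apply: (cvgM h); apply: (cvgB (cvg_cst _)).
exact: (cvgM (cvgM h h) (cvg_cst _)).
Qed.
End Degeneration.

(** * The border rank of the cube *)

Theorem theorem4p1 (R : realType) (q : nat) (hq : (5 <= q)%N) :
  border_rank (kron_pow (cw_tensor R q) 3) = ((q + 2) ^ 3)%N.
Proof.
apply/eqP; rewrite eqn_leq; apply/andP; split.
  apply: border_rank_leP; rewrite !expnS expn0 muln1 mulnA.
  exact: limit_of_rank_kron (limit_of_rank_kron (cw_border R q) (cw_border R q)) (cw_border R q).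
set T := kron_pow _ _.
have hle := rank_flattening_border T (@rank_contraction_koszul R q).
pose fr := [pred p : 'I_10 * index3 q | is_free (p.1 : nat, clamp3 (to_triple p.2))].
have hge : (#|{: 'I_10 * index3 q}| <=
    \rank (flattening (@cube_koszul R q) T) + #|fr|)%N.
  apply: rank_ge_of_kernel => x hx hfree.
  apply: (kernel_trivial hq) => [u k|p hp]; last exact: hfree.
  by rewrite -(flattening_cube hq x (u, k)); exact: hx.
have := leq_trans hge (leq_add hle (leqnn _)).
rewrite card_free // !card_prod !card_ord.
(* At this point 6 (q + 2)^3 - 4 <= 6 b, which forces (q + 2)^3 <= b. *)
move: (border_rank T) => b; rewrite -(subnK hq) addnK; move: (q - 5)%N => t.
rewrite !expnS expn0; nia.
Qed.
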